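(* Let $A$ be a finite or countable alphabet and let $\theta$ be a literal (anti)morphism onto $A^*$ (see context). Let $X\subseteq A^*$ be a $\theta$-invariant set, and let $Y$ be the minimal generating set of the smallest $\theta$-invariant free submonoid of $A^*$ which contains $X$. If $X$ is not a code, then $|Y|\le |X|-1$.
   Context: $A^*$ is the free monoid over $A$, with empty word $\varepsilon$. Standing assumption: $\theta:A^*\to A^*$ is a one-to-one correspondence of $A^*$ onto itself, is literal ($\theta(A)\subseteq A$), and is either a morphism ($\theta(xy)=\theta(x)\theta(y)$) or an antimorphism ($\theta(\varepsilon)=\varepsilon$ and $\theta(xy)=\theta(y)\theta(x)$ for all words $x,y$). A set $X$ is $\theta$-invariant if $\theta(X)=X$; a submonoid $M$ is $\theta$-invariant if $\theta(M)=M$. A set $X\subseteq A^*$ is a code if every equation $x_1\cdots x_m=y_1\cdots y_n$ with all $x_i,y_j\in X$ implies $m=n$ and $x_i=y_i$ for all $i$; a submonoid is free if it is generated by a code. The intersection of any non-empty family of $\theta$-invariant free submonoids of $A^*$ is a $\theta$-invariant free submonoid, so the smallest one containing $X$ exists. The minimal generating set of a submonoid $M$ is $(M\setminus\{\varepsilon\})\setminus(M\setminus\{\varepsilon\})^2$. *)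

(* Defs.v *)
From mathcomp Require Import all_boot.
From mathcomp Require Import boolp classical_sets functions cardinality.

Set Implicit Arguments.
Unset Strict Implicit.
Unset Printing Implicit Defensive.

Local Open Scope classical_set_scope.

(* Words over A are sequences: [::] is the empty word, ++ is concatenation. *)
Section Words.
Variable A : countType.
Implicit Types (theta : seq A -> seq A) (X M : set (seq A)).

Definition letters : set (seq A) := [set [:: a] | a in [set: A]].

Definition is_literal theta := theta @` letters `<=` letters.

Definition is_morphism theta :=
  forall x y, theta (x ++ y) = theta x ++ theta y.

Definition is_antimorphism theta :=
  theta [::] = [::] /\ forall x y, theta (x ++ y) = theta y ++ theta x.

Definition is_invariant theta X := theta @` X = X.

(* The factorisations s and t may be empty; in particular no code contains
   the empty word. *)
Definition is_code X := forall s t : seq (seq A),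
  (forall x, x \in s -> X x) -> (forall y, y \in t -> X y) ->
  flatten s = flatten t -> s = t.

Definition is_submonoid M :=
  M [::] /\ forall x y, M x -> M y -> M (x ++ y).

Definition generated_submonoid X : set (seq A) := smallest is_submonoid X.

Definition is_free_submonoid M :=
  exists2 C, is_code C & M = generated_submonoid C.

Definition is_invariant_free_submonoid theta M :=
  is_free_submonoid M /\ is_invariant theta M.

(* [smallest] is the intersection of all theta-invariant free submonoids
   containing X; it is itself one of them when theta is a bijective
   morphism or antimorphism. *)
Definition invariant_free_hull theta X : set (seq A) :=
  smallest (is_invariant_free_submonoid theta) X.

Definition minimal_generating_set M : set (seq A) :=
  let N := M `\ [::] in N `\` [set x ++ y | x in N & y in N].

End Words.

(* |Y| <= |X| - 1 as cardinal numbers, for X nonempty: |X| - 1 is the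
   cardinality of X with one (equivalently, any) element removed. It is
   |X| itself when X is infinite. *)
Definition card_le_pred (T U : Type) (Y : set T) (X : set U) :=
  exists2 x, X x & (Y #<= X `\ x)%card.

(* Main.v *)
(** A submonoid of a free monoid is free iff it is stable: [u], [v], [u w] and
    [w v] in [M] force [w] in [M]. Stability is inherited by intersections and by
    preimages under (anti)morphisms, so the free hull of an invariant set [X] is
    already invariant and hence equals the invariant free hull. This reduces the
    theorem to the classical defect theorem. For the latter, let [Y] be the base
    of the hull and send a word of the hull to its first factor over [Y]. This
    map sends the nonempty words of [X] onto [Y], because the words whose
    factorisation does not start with a given [y] form a strictly smaller stable
    submonoid. A nontrivial relation between nonempty words of [X] yields two
    distinct words with the same first factor. *)
Require Import Defs.
From mathcomp Require Import all_boot.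
From mathcomp Require Import boolp classical_sets functions cardinality.

Set Implicit Arguments.
Unset Strict Implicit.
Unset Printing Implicit Defensive.

Local Open Scope classical_set_scope.

Section Defect.
Variable A : countType.
Implicit Types (theta : seq A -> seq A) (C M X : set (seq A)).
Implicit Types (u v w x y : seq A) (s t : seq (seq A)).

(** * Factorisations over a set of words *)

Definition over C s := forall x, x \in s -> C x.

Lemma over_cons C x s : over C (x :: s) <-> C x /\ over C s.
Proof.
split=> [Cxs|[Cx Cs] y]; last by rewrite inE => /orP[/eqP->|/Cs].
by split=> [|y ys]; apply: Cxs; rewrite inE ?eqxx // ys orbT.
Qed.

Lemma over_cat C s t : over C (s ++ t) <-> over C s /\ over C t.
Proof.
split=> [Cst|[Cs Ct] y]; last by rewrite mem_cat => /orP[/Cs|/Ct].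
by split=> y ys; apply: Cst; rewrite mem_cat ys ?orbT.
Qed.

Lemma flatten_submonoid M s : is_submonoid M -> over M s -> M (flatten s).
Proof.
move=> [M0 MM]; elim: s => [//|x s IHs] /over_cons[Mx /IHs Ms] /=.
exact: MM.
Qed.

Lemma generated_submonoidP C :
  generated_submonoid C = [set flatten s | s in over C].
Proof.
apply/seteqP; split=> [m|_ [s Cs <-] M [subM CM]]; last first.
  by apply: flatten_submonoid => // x /Cs /CM.
apply; split; last first.
  by move=> x Cx; exists [:: x]; rewrite /= ?cats0 //; apply/over_cons; split.
split=> [|_ _ [s Cs <-] [t Ct <-]]; first by exists [::].
by exists (s ++ t); rewrite ?flatten_cat //; apply/over_cat.
Qed.

Lemma cat_prefix (T : Type) (a b c d : seq T) : a ++ b = c ++ d ->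
  (exists r, c = a ++ r) \/ (exists r, a = c ++ r).
Proof.
elim: a c => [|e a IHa] [|f c] /=; [by left; exists [::]|by left; exists (f :: c)
  |by right; exists (e :: a)|].
by case=> -> /IHa[[r ->]|[r ->]]; [left|right]; exists r.
Qed.

(** * Stability of free submonoids *)

Definition is_stable M :=
  forall u v w, M u -> M v -> M (u ++ w) -> M (w ++ v) -> M w.

Definition is_stable_submonoid M := is_submonoid M /\ is_stable M.

Lemma catIs (u v w : seq A) : u ++ v = u ++ w -> v = w.
Proof. by move/eqP; rewrite eqseq_cat // eqxx => /eqP. Qed.

Lemma free_stable M : is_free_submonoid M -> is_stable_submonoid M.
Proof.
case=> C codeC ->; split.
  split=> [N [[]]//|x y Cx Cy N NC].
  by case: (NC) => [[_ NN] _]; apply: NN; [apply: Cx|apply: Cy].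
(* The word [u w v] has the factorisations [s ++ q] and [p ++ t], which agree because [C] is a
   code. *)
rewrite generated_submonoidP => _ _ w [s Cs <-] [t Ct <-] [p Cp pE] [q Cq qE].
have spE : s ++ q = p ++ t.
  apply: codeC; [exact/over_cat|exact/over_cat|].
  by rewrite !flatten_cat pE qE catA.
case: (cat_prefix spE) => -[r rE].
  exists r; first by move: Cp; rewrite rE => /over_cat[].
  by move: pE; rewrite rE flatten_cat => /catIs.
(* Here [s] extends [p], so [u] is at least as long as [u w] and [w] is empty. *)
exists [::] => //=; case: w pE {qE} => // a w pE.
by have /(congr1 size) := pE; rewrite rE flatten_cat !size_cat; move: (size _) => n;
  rewrite -addnA => /eqP; rewrite -{1}[n]addn0 eqn_add2l addnS.
Qed.

(** * The base of a stable submonoid *)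

Section Base.
Variable M : set (seq A).
Hypothesis M_stable : is_stable_submonoid M.
Let Y := minimal_generating_set M.

Lemma base_sub : Y `<=` M.
Proof. by move=> y [[]]. Qed.

Lemma base_neq0 y : Y y -> y <> [::].
Proof. by case=> [[]]. Qed.

Lemma base_indecomposable x w : Y (x ++ w) -> M x -> x <> [::] -> M w -> w = [::].
Proof.
move=> [_ irr] Mx x0 Mw; apply: contrapT => w0; apply: irr.
by exists x => //; exists w.
Qed.

Lemma base_generates m : M m -> exists2 s, over Y s & flatten s = m.
Proof.
elim: {m}_.+1 {-2}m (ltnSn (size m)) => // n IHn m; rewrite ltnS => le_mn Mm.
have [->|m0] := pselect (m = [::]); first by exists [::].
have [Ym|nYm] := pselect (Y m).
  by exists [:: m]; rewrite /= ?cats0 //; apply/over_cons; split.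
have [x [Mx x0] [y [My y0] mE]] :
    [set x ++ y | x in M `\ [::] & y in M `\ [::]] m.
  by apply: contrapT => irr; apply: nYm; split.
have x_gt0 : 0 < size x by rewrite lt0n size_eq0; apply/eqP.
have y_gt0 : 0 < size y by rewrite lt0n size_eq0; apply/eqP.
rewrite -mE size_cat in le_mn.
have [|s Ys sE] := IHn x _ Mx.
  by apply: leq_trans le_mn; rewrite -addn1 leq_add2l.
have [|t Yt tE] := IHn y _ My.
  by apply: leq_trans le_mn; rewrite -add1n leq_add2r.
by exists (s ++ t); [exact/over_cat|rewrite flatten_cat sE tE].
Qed.

Lemma flatten_base s : over Y s -> M (flatten s).
Proof. by case: M_stable => sM _ Ys; apply: flatten_submonoid => // x /Ys/base_sub. Qed.

(** Equal words have comparable first factors. If one is the other followed by [w], stability puts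
    [w] in [M], and indecomposability makes [w] empty. *)
Lemma base_head x y s t : over Y (x :: s) -> over Y (y :: t) ->
  flatten (x :: s) = flatten (y :: t) -> x = y.
Proof.
have prefixE x' w s' t' : over Y (x' :: s') -> over Y ((x' ++ w) :: t') ->
    flatten (x' :: s') = flatten ((x' ++ w) :: t') -> w = [::].
  move=> /over_cons[Yx Ys] /over_cons[Yxw Yt] /=; rewrite -catA => /catIs E.
  apply: (base_indecomposable Yxw); [exact: base_sub|exact: base_neq0|].
  case: M_stable => _; apply; [exact: base_sub Yx|exact: flatten_base Yt| |].
    exact: base_sub.
  by rewrite -E; exact: flatten_base.
move=> Yxs Yyt E; case: (cat_prefix E) => -[w wE].
  by move: Yyt E; rewrite wE => Yyt E; rewrite (prefixE _ _ _ _ Yxs Yyt E) cats0.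
by move: Yxs E; rewrite wE => Yxs E; rewrite (prefixE _ _ _ _ Yyt Yxs) ?cats0.
Qed.

Lemma base_code : is_code Y.
Proof.
elim=> [|x s IHs] [|y t] // Ys Yt E.
- by have /over_cons[/base_neq0] := Yt; case: (y) E.
- by have /over_cons[/base_neq0] := Ys; case: (x) E.
have xy := base_head Ys Yt E; rewrite -xy /= in E *.
move/over_cons: Ys => [_ Ys]; move/over_cons: Yt => [_ Yt].
by rewrite (IHs t) //; exact: catIs E.
Qed.

Lemma stable_free : is_free_submonoid M.
Proof.
exists Y; first exact: base_code.
rewrite generated_submonoidP; apply/seteqP; split=> [m /base_generates[s]|_ [s Ys <-]].
  by exists s.
exact: flatten_base.
Qed.

(** The factorisation [r] of [w] begins that of [w v], so it is empty or has the same first factor.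
    Using [ohead] keeps the empty word in the set. *)
Lemma not_first_stable y : Y y ->
  is_stable_submonoid [set flatten s | s in [set s | over Y s /\ ohead s <> Some y]].
Proof.
move=> Yy; split; first split=> [|_ _ [s [Ys s0] <-] [t [Yt t0] <-]].
- by exists [::].
- exists (s ++ t); rewrite ?flatten_cat //.
  by split; [exact/over_cat|case: (s) s0].
move=> _ _ w [s [Ys _] <-] [t [Yt _] <-] [p [Yp _] pE] [q [Yq q0] qE].
have [r Yr rE] : exists2 r, over Y r & flatten r = w.
  apply: base_generates; case: M_stable => _.
  by apply; [exact: flatten_base Ys|exact: flatten_base Yt| |];
    rewrite -?pE -?qE; exact: flatten_base.
exists r => //; split=> //.
have qrt : q = r ++ t.
  by apply: base_code => //; [exact/over_cat|rewrite flatten_cat rE].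
by move: q0; rewrite qrt; case: (r).
Qed.

End Base.

(** * The stable hull under morphisms and antimorphisms *)

Lemma smallest_stable X : is_stable_submonoid (smallest is_stable_submonoid X).
Proof.
split; first split=> [M [[[]]]//|x y Hx Hy M MX].
  by case: (MX) => [[[_ MM] _] _]; apply: MM; [exact: Hx|exact: Hy].
move=> u v w Hu Hv Huw Hwv M MX; case: (MX) => [[_ +] _].
by apply; [exact: Hu|exact: Hv|exact: Huw|exact: Hwv].
Qed.

Lemma preimage_stable theta M : is_morphism theta \/ is_antimorphism theta ->
  is_stable_submonoid M -> is_stable_submonoid (theta @^-1` M).
Proof.
move=> th [[M0 MM] stM].
have th0 : theta [::] = [::].
  case: th => [th|[]//]; apply: size0nil; apply/eqP.
  by rewrite -(eqn_add2l (size (theta [::]))) -size_cat -th addn0.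
split; first split=> [|x y /= Mx My]; rewrite /preimage /=.
- by rewrite th0.
- by case: th => [->|[_ ->]]; exact: MM.
case: th => [th|[_ th]] u v w /=; rewrite !th => Mu Mv Muw Mwv.
  exact: stM Mu Mv Muw Mwv.
(* An antimorphism reverses products, so [u] and [v] exchange roles. *)
exact: stM Mv Mu Mwv Muw.
Qed.

Lemma morphism_inverse theta g : cancel theta g -> cancel g theta ->
  is_morphism theta \/ is_antimorphism theta -> is_morphism g \/ is_antimorphism g.
Proof.
move=> thK gK [th|[th0 th]]; [left|right; split] => [x y||x y].
- by rewrite -{1}[x]gK -{1}[y]gK -th thK.
- by rewrite -{1}th0 thK.
- by rewrite -{1}[x]gK -{1}[y]gK -th thK.
Qed.

(** The preimages of the hull under [theta] and under its inverse are stable submonoids containing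
    [X], so each contains the hull. *)
Lemma smallest_stable_invariant theta X : bijective theta ->
  is_morphism theta \/ is_antimorphism theta -> is_invariant theta X ->
  is_invariant theta (smallest is_stable_submonoid X).
Proof.
move=> [g thK gK] th thX; apply/seteqP; split=> [_ [x Hx <-]|x Hx].
  have : (theta @^-1` smallest is_stable_submonoid X) x; last by [].
  apply: Hx; split; first exact: preimage_stable th (smallest_stable X).
  by move=> z Xz M [_]; apply; rewrite -thX; exists z.
exists (g x); last exact: gK.
have : (g @^-1` smallest is_stable_submonoid X) x; last by [].
apply: Hx; split.
  exact: preimage_stable (morphism_inverse thK gK th) (smallest_stable X).
by rewrite -{1}thX => _ [z Xz <-] M [_]; rewrite thK; apply.
Qed.

Lemma invariant_free_hullE theta X : bijective theta ->
  is_morphism theta \/ is_antimorphism theta -> is_invariant theta X ->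
  invariant_free_hull theta X = smallest is_stable_submonoid X.
Proof.
move=> th_bij th thX; apply/seteqP; split=> m Hm.
  apply: Hm; split; last by move=> x Xx M [_]; apply.
  split; first exact: stable_free (smallest_stable X).
  exact: smallest_stable_invariant.
by move=> M [[/free_stable stM _] XM]; apply: Hm.
Qed.

(** * The defect theorem *)

Lemma not_code_relation X : ~ is_code X -> ~ X [::] ->
  exists x y s t, [/\ over X (x :: s), over X (y :: t), x <> y &
    flatten (x :: s) = flatten (y :: t)].
Proof.
move=> ncode X0; apply: contrapT => norel; apply: ncode.
(* Equal first factors are cancelled; as [[::]] is not in [X], neither side can run out before the
   other. *)
elim=> [|x s IHs] [|y t] // Xs Xt E.
- by case/over_cons: Xt; case: (y) E.
- by case/over_cons: Xs; case: (x) E.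
have xy : x = y by apply: contrapT => xy; apply: norel; exists x, y, s, t.
rewrite -xy /= in E *; move/over_cons: Xs => [_ Xs]; move/over_cons: Xt => [_ Xt].
by rewrite (IHs t) //; exact: catIs E.
Qed.

Lemma defect X : ~ is_code X ->
  card_le_pred (minimal_generating_set (smallest is_stable_submonoid X)) X.
Proof.
move=> ncode; set H := smallest _ X; set Y := minimal_generating_set H.
have stH : is_stable_submonoid H := smallest_stable X.
have XH : X `<=` H by move=> x Xx M [_]; apply.
have /choice[fact factP] : forall x, exists s, H x -> over Y s /\ flatten s = x.
  move=> x; have [/base_generates[s Ys sE]|nHx] := pselect (H x); first by exists s.
  by exists [::].
(* On [H] the default [[::]] is reached only at the empty word. *)
pose f x := head [::] (fact x).
have f_onto y : Y y -> exists x, [/\ X x, x <> [::] & f x = y].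
  move=> Yy; apply: contrapT => nof.
  (* If [y] is missed, no word of [X] has first factor [y], so by minimality of [H] some
     factorisation of [y] itself avoids starting with [y]. *)
  have [s [Ys s0] sE] : [set flatten s | s in [set s | over Y s /\ ohead s <> Some y]] y.
    apply: (base_sub Yy); split; first exact: (not_first_stable stH Yy).
    move=> x Xx; have [Yf fE] := factP _ (XH _ Xx).
    exists (fact x) => //; split=> // hd; apply: nof; exists x; split=> //.
      move=> x0; move: fE hd Yf; case: (fact x) => //= z s zE [zy] /over_cons[/base_neq0].
      by rewrite x0 in zE; case: (z) zE.
    by rewrite /f; case: (fact x) hd => //= z s [].
  apply: s0; have -> : s = [:: y]; last by [].
  apply: (base_code stH) => //; last by rewrite sE /= cats0.
  by apply/over_cons; split.
suff [x Xx onto] : exists2 x, X x & Y `<=` f @` (X `\ x).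
  exists x => //; apply: card_le_trans (card_image_le f _).
  exact: subset_card_le onto.
(* The empty word can be removed at once, since [f_onto] provides nonempty preimages. *)
have [X0|X0] := pselect (X [::]).
  by exists [::] => // y /f_onto[x [Xx x0 <-]]; exists x.
have [x [x' [s [t [Xs Xt xx' E]]]]] := not_code_relation ncode X0.
have Xx : X x by case/over_cons: Xs.
have Xx' : X x' by case/over_cons: Xt.
(* As [z] is nonempty, the product inherits its first factor over [Y] from [z]. *)
have factor z r : over X (z :: r) -> exists a q, [/\ over Y (a :: q),
    flatten (a :: q) = flatten (z :: r) & f z = a].
  move=> /over_cons[Xz Xr].
  have Hr : H (flatten r).
    by apply: flatten_submonoid; [case: stH|move=> ? /Xr/XH].
  have [Yz zE] := factP _ (XH _ Xz); have [Yr rE] := factP _ Hr.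
  rewrite /f; case: (fact z) zE Yz => [zE|a q zE Yz]; first by rewrite -zE in Xz.
  exists a, (q ++ fact (flatten r)); split=> //; last first.
    by rewrite /= flatten_cat rE catA -[_ ++ flatten q]/(flatten (a :: q)) zE.
  by rewrite -cat_cons; apply/over_cat.
have ff : f x = f x'.
  have [a [p [Yp pE ->]]] := factor _ _ Xs.
  have [b [q [Yq qE ->]]] := factor _ _ Xt.
  by apply: (base_head stH Yp Yq); rewrite pE qE.
(* After [x] is removed, [x'] still attains the value [f x]. *)
exists x => // y /f_onto[z [Xz _ <-]].
have [->|zx] := pselect (z = x); last by exists z.
by exists x'; [split=> // x'x; apply: xx'|].
Qed.

End Defect.

Theorem theorem1 (A : countType) (theta : seq A -> seq A) (X : set (seq A))
  (theta_bij : bijective theta)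
  (theta_literal : is_literal theta)
  (theta_morph : is_morphism theta \/ is_antimorphism theta)
  (X_inv : is_invariant theta X)
  (X_not_code : ~ is_code X) :
  card_le_pred (minimal_generating_set (invariant_free_hull theta X)) X.
Proof. by rewrite invariant_free_hullE //; exact: defect. Qed.
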